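(* Let $q=2^m$ and $r=2^h$ with $h\mid m$. Let $F=\mathbb{F}_q$, $K=\mathbb{F}_{q^2}$, $F'=\mathbb{F}_r$, let $U\subset K$ be the set defined in the context, let $V_1=\{x\in F\mid Tr_{F/F'}(x)=1\}$, let $c\in K^*$ and $V_c=cV_1$. Then the set $$H_r:=\{\lambda u\mid 1/\lambda\in V_c,\ u\in U\}$$ is a KM-arc of type $t=q/r$ with $t$-nucleus at $0$ in $K=AG(2,q)$.
   Context: Relative trace: $Tr_{F/F'}:F\to F'$, $Tr_{F/F'}(x)=x+x^r+\cdots+x^{q/r^2}+x^{q/r}$. Definition of $U$: let $K'=\mathbb{F}_{r^2}$ with $F'\subset K'\subseteq K$ and let $S'$ be the group of $(r+1)$-st roots of unity in $K'$. Let $\mathbf{u}$ be a generator of $S'$, $\tilde{\mathbf u}=\mathbf u^r$, and $b=\mathbf u+\tilde{\mathbf u}\in F'$. Let $(b_n)_{n\ge0}$ be the sequence in $F'$ given by $b_0=1$, $b_1=0$, $b_{n+1}=bb_n+b_{n-1}$. Fix $\mathbf i\in K$ with $\mathbf i+\mathbf i^q=1$; then $1,\mathbf i$ is a basis of $K$ over $F$. Put $u_i=b_i+b_{i+1}\mathbf i$ and $U=\{u_i\mid 0\le i\le r\}$. Polar representation of the plane: put $\bar x=x^q$, $\langle x,y\rangle=x\bar y+\bar xy\in F$ and $S=\{u\in K\mid u\bar u=1\}$. Points of $PG(2,q)$ are pairs $(x:z)$ with $x\in K$, $z\in F$, $(x,z)\neq(0,0)$, up to multiplication by $F^*$; lines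 are $[\alpha:\beta]=\{(x:z)\mid\langle\alpha,x\rangle+\beta z=0\}$, $\alpha\in K,\beta\in F$, $(\alpha,\beta)\ne(0,0)$. The affine plane $AG(2,q)=PG(2,q)\setminus[0:1]$ is identified with $K$ via $(x:1)\leftrightarrow x$; its lines are $\{x\in K\mid\langle u,x\rangle+\mu=0\}$ with $u\in S$, $\mu\in F$. A KM-arc of type $t$ in $PG(2,q)$ is a set of $q+t$ points meeting every line in $0$, $2$ or $t$ points. For $t=1$ it is an oval, whose tangent lines all pass through a unique point, called its nucleus or $1$-nucleus. For $t=2$ it is a hyperoval, and any point not on it is regarded as a $2$-nucleus. For $2<t<q$ it is known that all lines meeting it in exactly $t$ points pass through one common point, called its $t$-nucleus. *)

(* Defs.v *)
From mathcomp Require Import all_boot all_order all_algebra all_fingroup all_solvable all_field.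

Set Implicit Arguments.
Unset Strict Implicit.
Unset Printing Implicit Defensive.

Import GRing.Theory.
Local Open Scope ring_scope.

Definition subfield (K : finFieldType) (E : {set K}) : Prop :=
  divring_closed E.

(* The plane PG(2,q) in its polar model over K = F_{q^2}: the subfield F = F_q
   is given as a subset of K, so that q = #|F|. *)

Definition bar (K : finFieldType) (F : {set K}) (x : K) : K := x ^+ #|F|.

Definition form (K : finFieldType) (F : {set K}) (x y : K) : K :=
  x * bar F y + bar F x * y.

(* Nonzero pairs (x, z) with x in K and z in F; they are the homogeneous
   coordinates both of points (x:z) and of lines [x:z]. *)
Definition coords (K : finFieldType) (F : {set K}) : {set K * K} :=
  [set v | (v.2 \in F) && (v != (0, 0))].

(* The point (v.1 : v.2), encoded as the set of all its coordinate pairs. *)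
Definition point (K : finFieldType) (F : {set K}) (v : K * K) : {set K * K} :=
  [set (a * v.1, a * v.2) | a in F :\ 0].

Definition points (K : finFieldType) (F : {set K}) : {set {set K * K}} :=
  [set point F v | v in coords F].

(* The line [w.1 : w.2], as a set of points. *)
Definition line (K : finFieldType) (F : {set K}) (w : K * K) :
    {set {set K * K}} :=
  [set point F v | v in coords F & form F w.1 v.1 + w.2 * v.2 == 0].

Definition lines (K : finFieldType) (F : {set K}) : {set {set {set K * K}}} :=
  [set line F w | w in coords F].

(* The identification of K with AG(2,q). *)
Definition affine (K : finFieldType) (F : {set K}) (x : K) : {set K * K} :=
  point F (x, 1).

Definition KM_arc (K : finFieldType) (F : {set K}) (t : nat)
    (A : {set {set K * K}}) : Prop :=
  [/\ A \subset points F,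
      #|A| = (#|F| + t)%N
    & forall l, l \in lines F -> #|l :&: A| \in [:: 0%N; 2%N; t]].

(* For a KM-arc A of type 2 (a hyperoval) every point off A is a 2-nucleus; in
   the other types P has to be the one and only point common to all lines
   meeting A in exactly t points. *)
Definition nucleus (K : finFieldType) (F : {set K}) (t : nat)
    (A : {set {set K * K}}) (P : {set K * K}) : Prop :=
  [/\ P \in points F,
      t = 2%N -> P \notin A
    & t <> 2%N -> forall Q, Q \in points F ->
        ((forall l, l \in lines F -> #|l :&: A| = t -> Q \in l) <-> Q = P)].

(* The number of summands is the degree [F : F'], as #|F| = #|F'| ^ [F : F']. *)
Definition rel_trace (K : finFieldType) (F F' : {set K}) (x : K) : K :=
  \sum_(i < trunc_log #|F'| #|F|) x ^+ (#|F'| ^ i).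

Definition V1 (K : finFieldType) (F F' : {set K}) : {set K} :=
  [set x in F | rel_trace F F' x == 1].

Definition Vc (K : finFieldType) (F F' : {set K}) (c : K) : {set K} :=
  [set c * v | v in V1 F F'].

(* The (r+1)-st roots of unity in K', for r = #|F'|. *)
Definition roots_of_unity (K : finFieldType) (F' K' : {set K}) :
    {set {unit K}} :=
  [set x : {unit K} | (val x \in K') && (val x ^+ #|F'|.+1 == 1)].

Fixpoint bseq (K : finFieldType) (b : K) (n : nat) {struct n} : K :=
  match n with
  | 0 => 1
  | n1.+1 => match n1 with
             | 0 => 0
             | n2.+1 => b * bseq b n1 + bseq b n2
             end
  end.

Definition Uset (K : finFieldType) (F' : {set K}) (u ii : K) : {set K} :=
  let b := u + u ^+ #|F'| in
  [set bseq b i + bseq b i.+1 * ii | i : 'I_#|F'|.+1].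

(* 0 is not in Vc F F' c when c != 0, so the convention 0^-1 = 0 does not add
   l = 0. *)
Definition Hset (K : finFieldType) (F F' : {set K}) (u ii c : K) : {set K} :=
  [set l * v | l in [set l : K | l^-1 \in Vc F F' c], v in Uset F' u ii].

(* Main.v *)
Require Import Defs.
From mathcomp Require Import all_boot all_order all_algebra all_fingroup all_solvable all_field.
From mathcomp Require Import ring.

Set Implicit Arguments.
Unset Strict Implicit.
Unset Printing Implicit Defensive.

Import GRing.Theory.
Local Open Scope ring_scope.

(** Let [r = #|F'|], let [a] be the generator of the (r+1)-st roots of unity,
    so that [a ^+ r = a^-1], and put [b = a + a^-1].  As [1, ii] is a basis of
    [K] over [F], the points of [U] are the vectors [(b_i, b_(i+1))], and the
    recurrence has a Binet formula ([binet]):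
      [b * (s * b_i + t * b_(i+1)) = g * a ^+ i + g' / a ^+ i]
    with [g = t + s / a] and [g' = t + s * a]; for [s] and [t] in [F'] one has
    [g' = g ^+ r].  In other words [U] is the conic [x^2 + b x y + y^2 = 1] of
    the plane over [F'], it has nucleus 0 and no point at infinity, and it is
    parametrised by the roots of unity [a ^+ i].

    A point [u_i / (c * v)], with [v] in [V1], lies on the line with equation
    [form w x + l = 0] if and only if [S * b_i + T * b_(i+1) = l * v], where
    [S = form w (1 / c)] and [T = form w (ii / c)] are in [F].

    - If [l = 0], this is a condition on [i] only.  It says
      [g * (a ^+ i) ^+ 2 = g'], and in characteristic 2 squaring is injective,
      so that at most one [i] is left ([card_conic_kernel]).  The line therefore
      meets the set in nothing or in one ray [{u_i / (c * v)}], which has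
      [#|V1| = q / r] points ([card_V1]).

    - If [l <> 0], then [v] is determined by [i], and it belongs to [V1] when its
      trace is 1.  The trace is [F']-linear and the [b_i] are in [F'], so this
      reads [s * b_i + t * b_(i+1) = 1] with [s] and [t] in [F']: a line of the
      plane over [F'] which avoids the nucleus meets the conic in 0 or 2 points
      ([card_conic_secant]).

    Hence for [q / r <> 2] the lines which meet the set in [q / r] points are
    lines through 0, and each [i] gives one of them; those of [u_0 = 1] and
    [u_1 = ii] are already distinct, which makes 0 the nucleus. *)

(* Otherwise these names denote bounded sequences and bilinear forms. *)
Local Notation bseq := Defs.bseq.
Local Notation form := Defs.form.

(** * Finite subfields *)

Section Subfield.
Variables (K : finFieldType) (E : {set K}).
Hypothesis subE : subfield E.

Lemma subfield0 : 0 \in E.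
Proof. by have [E1 EB _] := subE; rewrite -(subrr 1) EB. Qed.

Lemma subfield1 : 1 \in E.
Proof. by have [] := subE. Qed.

Lemma subfieldB : {in E &, forall x y, x - y \in E}.
Proof. by have [] := subE. Qed.

Lemma subfieldD : {in E &, forall x y, x + y \in E}.
Proof.
by move=> x y Ex Ey; rewrite -(opprK y) -(sub0r y) !subfieldB ?subfield0.
Qed.

Lemma subfield_div : {in E &, forall x y, x / y \in E}.
Proof. by have [] := subE. Qed.

Lemma subfieldV : {in E, forall x, x^-1 \in E}.
Proof. by move=> x Ex; rewrite -div1r subfield_div ?subfield1. Qed.

Lemma subfieldM : {in E &, forall x y, x * y \in E}.
Proof. by move=> x y Ex Ey; rewrite -(invrK y) subfield_div ?subfieldV. Qed.

Lemma card_subfield_gt1 : (1 < #|E|)%N.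
Proof.
by rewrite (cardsD1 0) subfield0 (cardsD1 1) !inE oner_neq0 subfield1.
Qed.

(** Lagrange for the group of nonzero elements of [E], by way of the product of
    all of them: multiplication by [x] permutes the factors. *)
Lemma subfield_expr_card x : x \in E -> x ^+ #|E| = x.
Proof.
move=> Ex; have [->|x0] := eqVneq x 0.
  by rewrite expr0n eqn0Ngt (ltnW card_subfield_gt1).
have P0 : \prod_(y in E :\ 0) y != 0.
  by rewrite prodf_seq_neq0; apply/allP=> y _; apply/implyP; rewrite !inE => /andP[].
have -> : #|E| = #|E :\ 0|.+1 by rewrite (cardsD1 0) subfield0.
rewrite exprS; suff -> : x ^+ #|E :\ 0| = 1 by rewrite mulr1.
apply: (mulIf P0); rewrite mul1r -prodr_const -big_split /=.
rewrite [RHS](reindex_inj (mulfI x0)); apply: eq_bigl => y.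
rewrite !inE mulf_eq0 (negPf x0) /=; congr (_ && _).
apply/idP/idP=> [Ey|Exy]; first exact: subfieldM.
by rewrite -(mulKf x0 y) mulrC subfield_div.
Qed.

(** ['X^#|E| - 'X] has no more roots than the elements of [E].  This turns
    membership in a subfield into an equation. *)
Lemma mem_subfield x : (x \in E) = (x ^+ #|E| == x).
Proof.
apply/idP/eqP=> [|xE]; first exact: subfield_expr_card.
have szP : size ('X^#|E| - 'X : {poly K}) = #|E|.+1.
  by rewrite size_polyDl size_polyXn // size_polyN size_polyX ltnS card_subfield_gt1.
have P0 : ('X^#|E| - 'X : {poly K}) != 0 by rewrite -size_poly_eq0 szP.
apply: contraT => Ex.
have := @max_poly_roots _ _ (x :: enum E) P0; rewrite szP /= -cardE ltnn.
rewrite mem_enum Ex enum_uniq /=; apply => //.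
rewrite rootE !hornerE xE subrr eqxx /=.
apply/allP=> y; rewrite mem_enum => Ey.
by rewrite rootE !hornerE subfield_expr_card ?subrr.
Qed.

End Subfield.

(** * The relative trace and the size of [V1] *)

Section Trace.
Variables (K : finFieldType) (F F' : {set K}) (d : nat).
Hypotheses (subF : subfield F) (subF' : subfield F').
Hypotheses (cardF : #|F| = (#|F'| ^ d)%N) (charF' : [pchar K].-nat #|F'|).

Lemma rel_traceE x : rel_trace F F' x = \sum_(i < d) x ^+ (#|F'| ^ i).
Proof. by rewrite /rel_trace cardF trunc_expnK ?card_subfield_gt1. Qed.

Lemma rel_traceD x y : rel_trace F F' (x + y) = rel_trace F F' x + rel_trace F F' y.
Proof.
rewrite /rel_trace -big_split /=; apply: eq_bigr => i _.
by rewrite exprDn_pchar // pnatX charF'.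
Qed.

Lemma rel_traceZ a x : a \in F' -> rel_trace F F' (a * x) = a * rel_trace F F' x.
Proof.
move=> F'a; rewrite /rel_trace big_distrr /=; apply: eq_bigr => i _.
rewrite exprMn; congr (_ * _); elim: (nat_of_ord i) => [|n IHn] //.
by rewrite expnSr exprM IHn (subfield_expr_card subF').
Qed.

(** Raising the trace to the power [#|F'|] permutes its summands cyclically. *)
Lemma rel_trace_mem x : x \in F -> rel_trace F F' x \in F'.
Proof.
move=> Fx; rewrite (mem_subfield subF') rel_traceE.
have -> : (\sum_(i < d) x ^+ (#|F'| ^ i)) ^+ #|F'| = \sum_(i < d) x ^+ (#|F'| ^ i.+1).
  have h0 : (0 : K) ^+ #|F'| = 0 by rewrite (subfield_expr_card subF') ?subfield0.
  rewrite (big_morph (fun y => y ^+ #|F'|) (fun y z => exprDn_pchar y z charF') h0).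
  by apply: eq_bigr => i _; rewrite -exprM -expnSr.
have xd : x ^+ (#|F'| ^ d) = x by rewrite -cardF (subfield_expr_card subF).
case: d xd => [|e] xd; first by rewrite !big_ord0.
by rewrite big_ord_recr big_ord_recl /= xd expn0 expr1 addrC.
Qed.

(** The fibre consists of roots of a polynomial of degree
    [#|F'| ^ d.-1 = #|F| / #|F'|]. *)
Lemma card_rel_trace_fiber y : (#|[set x in F | rel_trace F F' x == y]| * #|F'| <= #|F|)%N.
Proof.
have r1 := card_subfield_gt1 subF'.
case Dd: d => [|e].
  have := card_subfield_gt1 subF; by rewrite cardF Dd.
rewrite cardF Dd expnSr leq_mul2r orbC.
pose P : {poly K} := \sum_(i < d) 'X^(#|F'| ^ i) - y%:P.
have szP : size P = (#|F'| ^ e).+1.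
  have sz1 : (size (\sum_(i < e) 'X^(#|F'| ^ i) - y%:P : {poly K})%R <= #|F'| ^ e)%N.
    rewrite (leq_trans (size_polyD _ _)) // geq_max size_polyN.
    rewrite (leq_trans (size_polyC_leq1 _)) ?expn_gt0 ?(ltnW r1) // andbT.
    rewrite (leq_trans (size_sum _ _ _)) //; apply/bigmax_leqP => i _.
    by rewrite size_polyXn ltn_exp2l.
  by rewrite /P Dd big_ord_recr /= addrAC addrC size_polyDl size_polyXn // ltnS.
have P0 : P != 0 by rewrite -size_poly_eq0 szP.
rewrite -ltnS -szP cardE max_poly_roots ?enum_uniq //.
apply/allP => x; rewrite mem_enum inE => /andP[_ /eqP Trx].
rewrite rootE /P -Trx rel_traceE hornerD hornerN hornerC horner_sum.
by under eq_bigr do rewrite hornerXn; rewrite subrr.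
Qed.

(** The [#|F'|] fibres of the trace add up to [#|F|], while none exceeds
    [#|F| / #|F'|]; so all of them attain this bound. *)
Lemma card_V1 : #|V1 F F'| = (#|F| %/ #|F'|)%N.
Proof.
have r1 := card_subfield_gt1 subF'; have r0 := ltnW r1.
have dvF : (#|F'| %| #|F|)%N.
  have := card_subfield_gt1 subF; rewrite cardF; case: (d) => // e _.
  by rewrite expnS dvdn_mulr.
have fibE : #|F| = (\sum_(y in F') #|[set x in F | rel_trace F F' x == y]|)%N.
  rewrite -sum1_card (partition_big (rel_trace F F') (mem F')) /=; last exact: rel_trace_mem.
  by apply: eq_bigr => y _; rewrite -sum1_card; apply: eq_bigl => x; rewrite inE.
have fib_le y : (#|[set x in F | rel_trace F F' x == y]| <= #|F| %/ #|F'|)%N.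
  by rewrite leq_divRL // card_rel_trace_fiber.
apply/eqP; rewrite eqn_leq fib_le /= -(leq_add2r (#|F' :\ 1| * (#|F| %/ #|F'|))).
rewrite -mulSn.
have -> : #|F' :\ 1|.+1 = #|F'| by rewrite (cardsD1 1 F') subfield1.
rewrite mulnC divnK // [X in (X <= _)%N]fibE (big_setD1 1) ?subfield1 //= leq_add2l.
by rewrite -sum_nat_const leq_sum.
Qed.
End Trace.
(** * The conic given by the recurrent sequence *)

Section Conic.
Variables (K : finFieldType) (r : nat) (a : K).
Hypotheses (char2 : 2%N \in [pchar K]) (r_gt1 : (1 < r)%N).
Hypothesis prim_a : r.+1.-primitive_root a.

Let b := a + a^-1.

Lemma addr_eq0_char2 (x y : K) : (x + y == 0) = (x == y).
Proof. by rewrite addr_eq0 oppr_pchar2. Qed.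

Lemma sqr_inj_char2 : injective (fun x : K => x ^+ 2).
Proof. exact: (fmorph_inj (pFrobenius_aut char2)). Qed.

Lemma prim_neq0 : a != 0.
Proof. by rewrite (prim_root_eq0 prim_a). Qed.

Lemma prim_addV_neq0 : b != 0.
Proof.
rewrite addr_eq0_char2; apply: contraTneq r_gt1 => aV.
have : a ^+ 2 == 1 by rewrite expr2 {2}aV divff ?prim_neq0.
rewrite -(prim_order_dvd prim_a) => /dvdn_leq -/(_ isT).
by rewrite -leqNgt.
Qed.

Lemma bseqSS (z : K) n : bseq z n.+2 = z * bseq z n.+1 + bseq z n.
Proof. by []. Qed.

(** The polynomial [X^2 + (z + 1/z) X + 1] of the recurrence has the roots [z]
    and [1/z]; applying one factor to the sequence leaves a geometric one. *)
Lemma bseq_step (z : K) n : z != 0 ->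
  bseq (z + z^-1) n.+1 + z * bseq (z + z^-1) n = z / z ^+ n.
Proof.
move=> z0; elim: n => [|n IHn]; first by rewrite /= add0r mulr1 expr0 divr1.
set B := z + z^-1 in IHn *.
have -> : bseq B n.+2 + z * bseq B n.+1
    = z^-1 * (bseq B n.+1 + z * bseq B n) + (z * bseq B n.+1 + z * bseq B n.+1).
  by rewrite bseqSS [in B * _]/B; field.
by rewrite IHn addrr_pchar2 // addr0 exprS invfM mulrCA.
Qed.

(** Both geometric sequences, the one for [a] and the one for [a^-1], are
    combined so as to isolate [b_n] and [b_(n+1)]. *)
Lemma binet n s t :
  b * (s * bseq b n + t * bseq b n.+1) =
  (t + s / a) * a ^+ n + (t + s * a) / a ^+ n.
Proof.
have a0 := prim_neq0.
have e1 := bseq_step n a0.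
have a0' : a^-1 != 0 by rewrite invr_eq0.
have := bseq_step n a0'; rewrite invrK (addrC a^-1) -/b => e2; rewrite -/b in e1.
have eb0 : b * bseq b n = a / a ^+ n + a^-1 * a ^+ n.
  rewrite exprVn invrK in e2; rewrite -e1 -e2 addrACA addrr_pchar2 // add0r.
  by rewrite -mulrDl.
have eb1 : b * bseq b n.+1 = a ^+ n + (a ^+ n)^-1.
  rewrite exprVn invrK in e2.
  have -> : b * bseq b n.+1 = a^-1 * (bseq b n.+1 + a * bseq b n)
      + a * (bseq b n.+1 + a^-1 * bseq b n) - (bseq b n + bseq b n).
    by rewrite {1}/b; field.
  by rewrite e1 e2 addrr_pchar2 // subr0 mulKf // mulVKf // addrC.
by rewrite mulrDr mulrCA eb0 (mulrCA b) eb1; ring.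
Qed.


Lemma expr_conj : a ^+ r = a^-1.
Proof.
apply: (mulIf prim_neq0).
by rewrite -exprSr prim_expr_order // mulVf ?prim_neq0.
Qed.

Lemma expr_prim_inj : injective (fun i : 'I_r.+1 => a ^+ i).
Proof.
move=> i j /eqP; rewrite (eq_prim_root_expr prim_a) !modn_small ?ltn_ord //.
by move=> /eqP/val_inj.
Qed.

(** With [z = a ^+ i] the equation is [g * z + g' / z = b], a quadratic one whose
    two roots have the product [g' / g].  Since [g' = g ^+ r] and [g = g' ^+ r],
    this product is itself an (r+1)-st root of unity, so the roots of unity which
    solve the equation come in pairs; the two roots are distinct because their
    sum [b / g] is not 0. *)
Lemma card_conic_secant s t : [pchar K].-nat r -> s ^+ r = s -> t ^+ r = t ->
  #|[set i : 'I_r.+1 | s * bseq b i + t * bseq b i.+1 == 1]| \in [:: 0%N; 2%N].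
Proof.
move=> charr sF tF; have a0 := prim_neq0.
set A := [set i | _]; have [->|/set0Pn[i Ai]] := eqVneq A set0; first by rewrite cards0.
pose g := t + s / a; pose g' := t + s * a.
have memA (j : 'I_r.+1) : (j \in A) = (g * a ^+ j + g' / a ^+ j == b).
  by rewrite inE -binet -(inj_eq (mulfI prim_addV_neq0)) mulr1.
have gr : g ^+ r = g' by rewrite exprDn_pchar // exprMn exprVn expr_conj invrK sF tF.
have g'r : g' ^+ r = g by rewrite exprDn_pchar // exprMn expr_conj sF tF.
have r0 : (0 < r)%N := ltnW r_gt1.
have g0 : g != 0.
  apply: contraTneq Ai => g0; move: gr; rewrite memA g0 expr0n eqn0Ngt r0 => <-.
  by rewrite !mul0r addr0 eq_sym prim_addV_neq0.
(* [a ^+ j] is the other root of the quadratic equation. *)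
have [j ajE] : {j : 'I_r.+1 | g' / (g * a ^+ i) = a ^+ j}.
  apply: (prim_rootP prim_a).
  rewrite exprMn exprVn exprMn -exprM mulnC exprM (prim_expr_order prim_a) expr1n mulr1.
  rewrite !exprS gr g'r (mulrC g'); apply: divff.
  by rewrite mulf_neq0 // -gr expf_neq0.
have ai0 k : a ^+ k != 0 by rewrite expf_neq0.
have g'E : g' = g * a ^+ i * a ^+ j by rewrite -ajE; field; rewrite g0 ai0.
have bE : b = g * (a ^+ i + a ^+ j).
  by move: Ai; rewrite memA => /eqP <-; rewrite g'E; field.
have ij : i != j.
  apply: contraNneq prim_addV_neq0 => ij.
  by rewrite bE ij addrr_pchar2 // mulr0.
suff -> : A = [set i; j] by rewrite cards2 ij.
apply/setP => k; rewrite memA !inE bE g'E.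
rewrite -(inj_eq (mulIf (ai0 k))) mulrDl divfK // -subr_eq0.
have -> : g * a ^+ k * a ^+ k + g * a ^+ i * a ^+ j - g * (a ^+ i + a ^+ j) * a ^+ k
  = g * ((a ^+ k - a ^+ i) * (a ^+ k - a ^+ j)) by ring.
by rewrite !mulf_eq0 (negPf g0) !subr_eq0 /= !(inj_eq expr_prim_inj).
Qed.

(** The equation reads [g * (a ^+ i) ^+ 2 = g'].  As squaring is injective, it
    determines [a ^+ i] unless [g = g' = 0], and this forces [s = t = 0]. *)
Lemma card_conic_kernel (s t : K) : (s != 0) || (t != 0) ->
  (#|[set i : 'I_r.+1 | (s * bseq b i + t * bseq b i.+1 == 0)%R]| <= 1)%N.
Proof.
move=> st0; have a0 := prim_neq0.
pose g := t + s / a; pose g' := t + s * a.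
have kerE (j : 'I_r.+1) : s * bseq b j + t * bseq b j.+1 = 0 -> g * (a ^+ j) ^+ 2 = g'.
  move=> sj; have := binet j s t; rewrite sj mulr0 => /esym/eqP.
  rewrite -/g -/g' addr_eq0_char2 => /eqP gj.
  by rewrite expr2 mulrA gj divfK ?expf_neq0.
have g0 (i : 'I_r.+1) : s * bseq b i + t * bseq b i.+1 = 0 -> g != 0.
  move=> /kerE gi; apply: contraTneq st0 => g0; move: gi; rewrite g0 mul0r => /esym g'0.
  have s0 : s = 0.
    apply: (mulIf prim_addV_neq0); rewrite mul0r -[RHS](addr0 0) -{1}g0 -g'0 /g /g'.
    by rewrite addrACA addrr_pchar2 // add0r mulrDr addrC.
  by move: g0; rewrite /g s0 mul0r addr0 => ->; rewrite eqxx.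
apply/card_le1_eqP => i j; rewrite !inE => /eqP si /eqP sj.
apply: expr_prim_inj.
apply/sqr_inj_char2/(mulfI (g0 i si)).
by rewrite !kerE.
Qed.

(** Points of the conic lie on different rays through 0: proportional vectors
    have [v' / a ^+ i = v / a ^+ j] and [v' * a ^+ i = v * a ^+ j] by
    [bseq_step], and the product of both equations is [v' ^+ 2 = v ^+ 2]. *)
Lemma conic_rays_disjoint v v' (i j : 'I_r.+1) :
    v != 0 -> v' * bseq b i = v * bseq b j -> v' * bseq b i.+1 = v * bseq b j.+1 ->
  v' = v /\ i = j.
Proof.
move=> v0 e0 e1; have a0 := prim_neq0.
have ai0 k : a ^+ k != 0 by rewrite expf_neq0.
have eV : v' / a ^+ i = v / a ^+ j.
  apply: (mulfI a0); rewrite !(mulrCA a) -!bseq_step // -/b.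
  by rewrite !mulrDr e1 mulrCA e0 mulrCA.
have a0' : a^-1 != 0 by rewrite invr_eq0.
have eX : v' * a ^+ i = v * a ^+ j.
  have S k : a ^+ k = a * (bseq b k.+1 + a^-1 * bseq b k).
    have := bseq_step k a0'; rewrite invrK (addrC a^-1) -/b => ->.
    by rewrite exprVn invrK mulVKf.
  rewrite !S !(mulrCA _ a); congr (a * _).
  by rewrite !mulrDr e1 mulrCA e0 mulrCA.
have vv : v' = v.
  apply: sqr_inj_char2; rewrite !expr2.
  have sqE k (w : K) : w * w = (w / a ^+ k) * (w * a ^+ k) by field.
  by rewrite (sqE i v') eV eX -sqE.
split=> //; apply: expr_prim_inj.
by apply: (mulfI v0); rewrite -{1}vv.
Qed.

End Conic.

(** The multiplicative group of [K'] is cyclic of order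
    [r ^ 2 - 1 = (r - 1) * (r + 1)], so it contains an element [y] of order
    [r + 1]; the generator [u] has [y] among its powers. *)
Lemma prim_root_of_generator (K : finFieldType) (F' K' : {set K}) (u : {unit K}) :
    subfield K' -> (1 < #|F'|)%N -> #|K'| = (#|F'| ^ 2)%N ->
    generator (roots_of_unity F' K') u ->
  #|F'|.+1.-primitive_root (val u).
Proof.
move=> subK' r1 cardK' /eqP gen_u; set r := #|F'| in r1 cardK' *.
pose N := (r ^ 2).-1.
have N0 : (0 < N)%N by rewrite /N; case: (r) r1 => [|[|n]].
have cardK'0 : #|K' :\ 0| = N.
  by rewrite /N -cardK' (cardsD1 0 K') (subfield0 subK').
have [z /[!mem_enum] K'z prim_z] : exists2 z, z \in enum (K' :\ 0) & N.-primitive_root z.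
  apply/hasP; apply: has_prim_root; rewrite ?enum_uniq -?cardE ?cardK'0 //.
  apply/allP=> x; rewrite mem_enum !inE => /andP[x0 K'x].
  apply/unity_rootP/(mulfI x0); rewrite mulr1 -exprS prednK ?expn_gt0 ?(ltnW r1) //.
  by rewrite -cardK' (subfield_expr_card subK').
have NE : N = (r.-1 * r.+1)%N by rewrite /N -subn1 -(exp1n 2) subn_sqr addn1 subn1.
have r'0 : (0 < r.-1)%N by case: (r) r1 => [|[|n]].
have dvN : (r.+1 %| N)%N by rewrite NE dvdn_mull.
have := dvdn_prim_root prim_z dvN; rewrite NE mulnK //.
set y := z ^+ _ => prim_y.
have uy : y \is a GRing.unit by rewrite unitfE (prim_root_eq0 prim_y).
have K'y : y \in K'.
  rewrite (mem_subfield subK') -exprM mulnC exprM.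
  by rewrite (subfield_expr_card subK') //; move: K'z; rewrite !inE => /andP[].
have /cycleP[k yk] : FinRing.unit K uy \in <[u]>%g.
  by rewrite -gen_u !inE K'y /= (prim_expr_order prim_y).
have : u \in roots_of_unity F' K' by rewrite gen_u cycle_id.
rewrite inE => /andP[_ /eqP ur].
have [d prim_u dr] := prim_order_exists (ltn0Sn r) ur.
suff rd : (r.+1 %| d)%N by have /eqP -> : r.+1 == d by rewrite eqn_dvd rd dr.
rewrite (prim_order_dvd prim_y) -[y]/(val (FinRing.unit K uy)) yk FinRing.val_unitX.
by rewrite -exprM mulnC exprM (prim_expr_order prim_u) expr1n.
Qed.

(** * The polar model of the plane *)

Section Plane.
Variables (K : finFieldType) (F : {set K}).
Hypotheses (subF : subfield F) (charF : [pchar K].-nat #|F|).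
Hypothesis cardK : #|K| = (#|F| ^ 2)%N.

Lemma barZ k x : k \in F -> bar F (k * x) = k * bar F x.
Proof. by move=> Fk; rewrite /bar exprMn (subfield_expr_card subF). Qed.

Lemma formC x y : form F x y = form F y x.
Proof. by rewrite /Defs.form addrC mulrC (mulrC x). Qed.

Lemma formDr w x y : form F w (x + y) = form F w x + form F w y.
Proof. by rewrite /Defs.form /bar exprDn_pchar // !mulrDr addrACA. Qed.

Lemma formZr w k x : k \in F -> form F w (k * x) = k * form F w x.
Proof. by move=> Fk; rewrite /Defs.form barZ // mulrDr !(mulrCA _ k). Qed.

Lemma form0r w : form F w 0 = 0.
Proof. by rewrite -[X in form _ _ X](mul0r 0) formZr ?mul0r ?subfield0. Qed.

Lemma form_mem w x : form F w x \in F.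
Proof.
rewrite (mem_subfield subF) /form /bar exprDn_pchar // !exprMn -!exprM.
by rewrite !(mulnn #|F|) -cardK !expf_card addrC.
Qed.

(** The form is nondegenerate and [y, ii * y] is a basis of [K] over [F]. *)
Lemma form_eq0_basis w y ii : y != 0 -> ii \notin F ->
  form F w y = 0 -> form F w (ii * y) = 0 -> w = 0.
Proof.
move=> y0 ii0 wy wiiy.
have : bar F w * y * (ii - bar F ii) = form F w (ii * y) - bar F ii * form F w y.
  by rewrite /Defs.form /bar exprMn; ring.
rewrite wy wiiy mulr0 subr0.
move/eqP; rewrite !mulf_eq0 subr_eq0 (negPf y0) (eq_sym ii) /bar -(mem_subfield subF).
by rewrite (negPf ii0) !orbF expf_eq0 => /andP[_ /eqP].
Qed.

Lemma point_id v : v \in point F v.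
Proof.
apply/imsetP; exists 1; last by rewrite !mul1r; case: v.
by rewrite !inE oner_neq0 subfield1.
Qed.

Lemma pointZ k v : k \in F -> k != 0 -> point F (k * v.1, k * v.2) = point F v.
Proof.
move=> Fk k0; apply/setP => x; apply/imsetP/imsetP=> [] [a] /=; rewrite !inE => /andP[a0 Fa] ->.
  exists (a * k); last by rewrite -!mulrA.
  by rewrite !inE mulf_neq0 // subfieldM.
exists (a / k); last by rewrite !mulrA divfK.
by rewrite !inE mulf_neq0 ?invr_eq0 // subfield_div.
Qed.

Lemma mem_line v w :
  v \in coords F -> (point F v \in line F w) = (form F w.1 v.1 + w.2 * v.2 == 0).
Proof.
move=> Cv; apply/imsetP/idP => [[v' /[!inE] /andP[_ v'w] vv']|vw]; last first.
  by exists v; rewrite // inE Cv.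
have /imsetP[k /[!inE] /andP[k0 Fk] ->] : v \in point F v' by rewrite -vv' point_id.
by rewrite formZr //= mulrCA -mulrDr (eqP v'w) mulr0.
Qed.

Lemma coords1 x : (x, 1) \in coords F.
Proof. by rewrite inE /= subfield1 // xpair_eqE oner_eq0 andbF. Qed.

Lemma affine_inj : injective (affine F).
Proof.
move=> x y xy; have /imsetP[k _ [xk]] : (x, 1) \in affine F y by rewrite -xy point_id.
by rewrite mulr1 => k1; rewrite xk -k1 mul1r.
Qed.

Lemma mem_line_affine x w : (affine F x \in line F w) = (form F w.1 x + w.2 == 0).
Proof. by rewrite mem_line ?coords1 // mulr1. Qed.

Lemma affine_point x : affine F x \in points F.
Proof. by apply: imset_f; exact: coords1. Qed.

Lemma card_line_affine (A : {set K}) w :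
  #|line F w :&: [set affine F x | x in A]| = #|[set x in A | form F w.1 x + w.2 == 0]|.
Proof.
rewrite -(card_imset _ affine_inj); apply: eq_card => P; apply/setIP/imsetP.
  move=> [lP /imsetP[x Ax Px]]; exists x => //.
  by rewrite inE Ax -mem_line_affine -Px.
by case=> x /[!inE] /andP[Ax xw] ->; rewrite mem_line_affine xw imset_f.
Qed.

End Plane.

(** * The line intersections of the arc *)

Section Arc.
Variables (K : finFieldType) (F F' : {set K}) (d : nat) (a ii c : K).
Hypotheses (char2 : 2%N \in [pchar K]) (cardK : #|K| = (#|F| ^ 2)%N).
Hypotheses (subF : subfield F) (subF' : subfield F') (F'F : F' \subset F).
Hypotheses (cardF : #|F| = (#|F'| ^ d)%N) (charF' : [pchar K].-nat #|F'|).
Hypotheses (prim_a : #|F'|.+1.-primitive_root a) (F'b : a + a^-1 \in F').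
Hypotheses (Fii : ii \notin F) (c0 : c != 0).

Let r := #|F'|.
Let b := a + a^-1.
Let Tr := rel_trace F F'.

Lemma charF : [pchar K].-nat #|F|.
Proof. by rewrite cardF pnatX charF'. Qed.

Lemma bseq_mem n : bseq b n \in F'.
Proof.
suff: (bseq b n \in F') && (bseq b n.+1 \in F') by case/andP.
elim: n => [|n /andP[IH0 IH1]]; first by rewrite subfield0 ?subfield1.
by rewrite IH1 bseqSS subfieldD ?subfieldM.
Qed.

Lemma bseq_memF n : bseq b n \in F.
Proof. exact: (subsetP F'F) (bseq_mem n). Qed.

Definition arc_point (k : 'I_r.+1 * K) : K :=
  (bseq b k.1 + bseq b k.1.+1 * ii) / (c * k.2).

Definition arc_params : {set 'I_r.+1 * K} := setX setT (V1 F F').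

Lemma mem_arc_params k : (k \in arc_params) = (k.2 \in V1 F F').
Proof. by case: k => i v; rewrite in_setX in_setT. Qed.

Lemma V1_mem v : v \in V1 F F' -> v \in F.
Proof. by rewrite inE => /andP[]. Qed.

Lemma V1_neq0 v : v \in V1 F F' -> v != 0.
Proof.
rewrite inE => /andP[_]; apply: contraTneq => ->.
by rewrite -[X in rel_trace _ _ X](mul0r 0) rel_traceZ ?subfield0 // mul0r eq_sym oner_eq0.
Qed.

(** The set as the image of the index set [arc_params], on which [arc_point] is
    injective; every count below is one of pairs [(i, v)]. *)
Lemma HsetE u : u + u ^+ r = b -> Hset F F' u ii c = arc_point @: arc_params.
Proof.
move=> ub; apply/setP=> x; apply/imset2P/imsetP.
  case=> l w; rewrite inE => /imsetP[v Vv lv] /imsetP[i _ ->] ->.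
  exists (i, v); first by rewrite mem_arc_params.
  by rewrite /arc_point /= -lv invrK mulrC -/r ub.
case=> -[i v]; rewrite mem_arc_params => Vv ->.
exists (c * v)^-1 (bseq b i + bseq b i.+1 * ii); last exact: mulrC.
  by rewrite inE invrK imset_f.
by apply/imsetP; exists i; rewrite //= -/r ub.
Qed.

Lemma basis_inj (x y x' y' : K) : x \in F -> y \in F -> x' \in F -> y' \in F ->
  x + y * ii = x' + y' * ii -> x = x' /\ y = y'.
Proof.
move=> Fx Fy Fx' Fy' e.
have e' : (y' - y) * ii = x - x' by rewrite mulrBl -[x](addrK (y * ii)) e; ring.
have yy : y = y'.
  apply/eqP; rewrite eq_sym -subr_eq0; apply: contraR Fii => yy0.
  by rewrite -(mulKf yy0 ii) e' mulrC subfield_div ?subfieldB.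
by split=> //; move: e; rewrite yy => /addIr.
Qed.

Lemma conic_point_neq0 (i : 'I_r.+1) : bseq b i + bseq b i.+1 * ii != 0.
Proof.
apply/eqP=> u0.
have [||||| b0 b1] := @basis_inj (bseq b i) (bseq b i.+1) 0 0; rewrite ?bseq_memF ?subfield0 //.
  by rewrite u0 mul0r addr0.
have := @conic_rays_disjoint _ _ _ char2 prim_a 1 0 i i (oner_neq0 _).
by rewrite !mul0r !mul1r b0 b1 => /(_ erefl erefl)[/eqP]; rewrite eq_sym oner_eq0.
Qed.

Lemma arc_point_inj : {in arc_params &, injective arc_point}.
Proof.
move=> [i v] [j w]; rewrite !mem_arc_params /= => Vv Vw.
have [v0 w0] := (V1_neq0 Vv, V1_neq0 Vw).
have [Fv Fw] := (V1_mem Vv, V1_mem Vw).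
rewrite /arc_point /= => /eqP.
rewrite eqr_div ?mulf_neq0 // !(mulrCA _ c) (inj_eq (mulfI c0)) => /eqP e.
have [||||| e0 e1] := @basis_inj (w * bseq b i) (w * bseq b i.+1) (v * bseq b j) (v * bseq b j.+1).
- by rewrite subfieldM ?bseq_memF.
- by rewrite subfieldM ?bseq_memF.
- by rewrite subfieldM ?bseq_memF.
- by rewrite subfieldM ?bseq_memF.
- by move: e; rewrite -!mulrA -!mulrDr !(mulrC _ w) !(mulrC _ v).
by have [-> ->] := conic_rays_disjoint char2 prim_a v0 e0 e1.
Qed.

Lemma card_arc : #|arc_point @: arc_params| = (#|F| + #|F| %/ r)%N.
Proof.
rewrite (card_in_imset arc_point_inj) cardsX cardsT card_ord.
rewrite (card_V1 subF subF' cardF charF') mulSn addnC mulnC divnK //.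
have := card_subfield_gt1 subF; rewrite cardF; case: (d) => // e _.
by rewrite expnS dvdn_mulr.
Qed.

Lemma card_arc_on (P : pred K) :
  #|[set x in arc_point @: arc_params | P x]| = #|[set k in arc_params | P (arc_point k)]|.
Proof.
rewrite -(card_in_imset (f := arc_point)); last first.
  by move=> k l; rewrite inE => /andP[kA _]; rewrite inE => /andP[lA _]; apply: arc_point_inj.
apply: eq_card => x; rewrite inE; apply/andP/imsetP.
  by case=> /imsetP[k kA ->] Pk; exists k; rewrite // inE kA.
by case=> k; rewrite inE => /andP[kA Pk] ->; rewrite imset_f.
Qed.

Lemma arc_point_on_line w l k : k \in arc_params ->
  (form F w (arc_point k) + l == 0) =
  (form F w c^-1 * bseq b k.1 + form F w (ii / c) * bseq b k.1.+1 == l * k.2).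
Proof.
rewrite mem_arc_params => Vk; have k0 := V1_neq0 Vk; have Fk := V1_mem Vk.
have -> : arc_point k = k.2^-1 * (bseq b k.1 * c^-1 + bseq b k.1.+1 * (ii / c)).
  by rewrite /arc_point invfM; ring.
rewrite formZr ?subfieldV // formDr ?charF // !(formZr subF _ _ (bseq_memF _)).
rewrite addr_eq0_char2 // -(inj_eq (mulfI k0)) mulVKf // (mulrC k.2).
by rewrite !(mulrC (bseq _ _)).
Qed.

Lemma card_arc_origin w :
  #|[set x in arc_point @: arc_params | form F w x + 0 == 0]| =
  (#|[set i : 'I_r.+1 |
      (form F w c^-1 * bseq b i + form F w (ii / c) * bseq b i.+1 == 0)%R]|
   * (#|F| %/ r))%N.
Proof.
rewrite card_arc_on -(card_V1 subF subF' cardF charF') -cardsX.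
apply: eq_card => -[i v]; rewrite [RHS]in_setX andbC [in LHS]inE inE.
rewrite -[v \in V1 F F']/((i, v).2 \in _) -mem_arc_params.
by case kA: (_ \in _); rewrite //= arc_point_on_line // mul0r.
Qed.

(** The solutions [(i, v)] form the graph of a function of [i]; taking traces in
    [l * v = S * b_i + T * b_(i+1)] leaves a line of the plane over [F']. *)
Lemma card_arc_off_origin w l : l \in F -> l != 0 ->
  #|[set x in arc_point @: arc_params | form F w x + l == 0]| \in [:: 0%N; 2%N].
Proof.
move=> Fl l0; rewrite card_arc_on.
pose s := form F w c^-1 / l; pose t := form F w (ii / c) / l.
have [Fs Ft] : s \in F /\ t \in F by split; apply: subfield_div; rewrite ?form_mem ?charF.
pose v (i : 'I_r.+1) := s * bseq b i + t * bseq b i.+1.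
have Fv i : v i \in F.
  by apply: (subfieldD subF); apply: (subfieldM subF); rewrite ?bseq_memF.
have TrvE i : Tr (v i) = Tr s * bseq b i + Tr t * bseq b i.+1.
  rewrite /Tr /v rel_traceD // !(mulrC _ (bseq _ _)).
  by rewrite !(rel_traceZ F subF' _ (bseq_mem _)).
have lvE (i : 'I_r.+1) : form F w c^-1 * bseq b i + form F w (ii / c) * bseq b i.+1 = l * v i.
  by rewrite /v /s /t; field.
pose A := [set i : 'I_r.+1 | Tr s * bseq b i + Tr t * bseq b i.+1 == 1].
have -> : [set k in arc_params | form F w (arc_point k) + l == 0] =
    [set (i, v i) | i in A].
  apply/setP=> k; rewrite inE; apply/andP/imsetP.
    case=> kA; rewrite arc_point_on_line // => /eqP kl.
    have kv : k.2 = v k.1.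
      by apply: (mulfI l0); rewrite -kl lvE.
    exists k.1; last by rewrite -kv; case: (k).
    by move: kA; rewrite mem_arc_params !inE -TrvE -kv => /andP[].
  case=> i; rewrite inE -TrvE => Tri ->.
  have kA : (i, v i) \in arc_params by rewrite mem_arc_params inE Fv.
  by rewrite kA arc_point_on_line //; split=> //; apply/eqP/lvE.
rewrite card_imset; last by move=> i j [].
have TrF' x : x \in F -> Tr x ^+ r = Tr x.
  by move=> Fx; apply/eqP; rewrite -(mem_subfield subF') (rel_trace_mem subF subF' cardF).
by apply: (card_conic_secant char2); rewrite ?card_subfield_gt1 ?TrF'.
Qed.

Lemma card_line_arc w : w \in coords F ->
  #|line F w :&: [set affine F x | x in arc_point @: arc_params]|
    \in [:: 0%N; if w.2 == 0 then (#|F| %/ r)%N else 2%N].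
Proof.
case: w => w l; rewrite inE /= => /andP[Fl w0].
rewrite card_line_affine //=; have [l0|l0] := eqVneq l 0; last first.
  exact: card_arc_off_origin.
rewrite l0 card_arc_origin.
suff: (#|[set i : 'I_r.+1 |
      (form F w c^-1 * bseq b i + form F w (ii / c) * bseq b i.+1 == 0)%R]| <= 1)%N.
  by case: (#|_|) => [|[|//]] _; rewrite !inE ?mul0n ?mul1n eqxx ?orbT.
apply: (card_conic_kernel char2) => //; rewrite ?card_subfield_gt1 //.
rewrite -negb_and; apply: contra w0 => /andP[/eqP w1 /eqP wi].
rewrite l0 xpair_eqE eqxx andbT; apply/eqP.
by apply: (form_eq0_basis subF _ Fii w1 wi); rewrite invr_eq0.
Qed.

(** In characteristic 2 the form is alternating, so the line through 0 and the
    point [w] has the coordinates [(w, 0)]. *)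
Lemma card_line_ray (i : 'I_r.+1) :
  let w := (bseq b i + bseq b i.+1 * ii) / c in
  #|line F (w, 0) :&: [set affine F x | x in arc_point @: arc_params]| = (#|F| %/ r)%N.
Proof.
move=> w.
have wi : form F w c^-1 * bseq b i + form F w (ii / c) * bseq b i.+1 = 0.
  rewrite !(mulrC _ (bseq _ _)) -!(formZr subF _ _ (bseq_memF _)) -formDr ?charF //.
  have -> : bseq b i / c + bseq b i.+1 * (ii / c) = w by rewrite /w; ring.
  by rewrite /Defs.form mulrC addrr_pchar2.
have w0 : w != 0 by rewrite mulf_neq0 ?invr_eq0 ?conic_point_neq0.
rewrite card_line_affine //= card_arc_origin.
set A := [set i | _].
suff /eqP -> : #|A| == 1%N by rewrite mul1n.
rewrite eqn_leq; apply/andP; split; last first.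
  by apply/card_gt0P; exists i; rewrite inE wi.
apply: (card_conic_kernel char2) => //; rewrite ?card_subfield_gt1 //.
rewrite -negb_and; apply: contra w0 => /andP[/eqP w1 /eqP w2].
by apply/eqP/(form_eq0_basis subF _ Fii w1 w2); rewrite invr_eq0.
Qed.

End Arc.

Theorem theorem5 (m h q r : nat) (hq : q = (2 ^ m)%N) (hr : r = (2 ^ h)%N)
    (hhm : (h %| m)%N)
    (K : finFieldType) (hK : #|K| = (q ^ 2)%N)
    (F F' K' : {set K})
    (hF : subfield F) (cardF : #|F| = q)
    (hF' : subfield F') (cardF' : #|F'| = r)
    (hK' : subfield K') (cardK' : #|K'| = (r ^ 2)%N)
    (F'F : F' \subset F) (F'K' : F' \subset K')
    (u : {unit K}) (hu : generator (roots_of_unity F' K') u)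
    (ii : K) (hii : ii + ii ^+ q = 1)
    (c : K) (hc : c != 0) :
  let H := [set affine F x | x in Hset F F' (val u) ii c] in
  KM_arc F (q %/ r)%N H /\ nucleus F (q %/ r)%N H (affine F 0).
Proof.
move=> H.
have char2 : 2%N \in [pchar K].
  by apply: (@card_finPcharP _ _ (m * 2)) => //; rewrite expnM -hq.
have char2X n : [pchar K].-nat (2 ^ n)%N by rewrite pnatX pnatE ?char2.
have charF' : [pchar K].-nat #|F'| by rewrite cardF' hr.
have charF : [pchar K].-nat #|F| by rewrite cardF hq.
have qr : #|F| = (#|F'| ^ (m %/ h))%N.
  by rewrite cardF' hr -expnM mulnC divnK // -hq.
have cardK : #|K| = (#|F| ^ 2)%N by rewrite cardF.
have r1 := card_subfield_gt1 hF'.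
have prim_u : #|F'|.+1.-primitive_root (val u).
  by apply: prim_root_of_generator hK' r1 _ hu; rewrite cardF'.
have ur := expr_conj prim_u; set a := val u in prim_u ur *.
have F'b : a + a^-1 \in F'.
  rewrite (mem_subfield hF') exprDn_pchar // exprVn ur invrK.
  by rewrite addrC.
have Fii : ii \notin F.
  apply/negP=> /(subfield_expr_card hF); rewrite cardF => iiq.
  by move/eqP: hii; rewrite iiq addrr_pchar2 // eq_sym oner_eq0.
have HE : Hset F F' a ii c = arc_point a ii c @: arc_params F F'.
  by apply: HsetE => //; rewrite ur.
have conic_neq0 := conic_point_neq0 char2 hF hF' F'F prim_u F'b Fii.
have memL w : w \in coords F ->
    #|line F w :&: H| \in [:: 0%N; if w.2 == 0 then (q %/ r)%N else 2%N].
  rewrite /H HE -cardF -cardF'.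
  exact: (card_line_arc char2 cardK hF hF' F'F qr charF' prim_u F'b Fii hc).
have tangent (i : 'I_#|F'|.+1) :
    #|line F ((bseq (a + a^-1) i + bseq (a + a^-1) i.+1 * ii) / c, 0) :&: H| = (q %/ r)%N.
  rewrite /H HE -cardF -cardF'.
  exact: (card_line_ray char2 hF hF' F'F qr charF' prim_u F'b Fii hc i).
have t0 : (0 < q %/ r)%N.
  by rewrite -cardF -cardF' divn_gt0 ?(ltnW r1) // subset_leq_card.
split; split.
- by apply/subsetP=> P /imsetP[x _ ->]; apply: affine_point.
- rewrite (card_imset _ (affine_inj hF)) HE -cardF -cardF'.
  exact: (card_arc char2 hF hF' F'F qr charF' prim_u F'b Fii hc).
- move=> l /imsetP[w Cw ->]; have := memL w Cw.
  by case: eqP => _; rewrite !inE => /orP[]->; rewrite ?orbT.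
- exact: affine_point.
- move=> _; apply/imsetP=> -[x + /(affine_inj hF) x0]; rewrite -x0 HE.
  case/imsetP=> k; rewrite mem_arc_params => /(V1_neq0 hF') k0 /esym/eqP; apply/negP.
  by rewrite mulf_neq0 ?invr_eq0 ?(mulf_neq0 hc) ?conic_neq0.
- move=> t2 Q /imsetP[v Cv ->{Q}]; split=> [vl|->]; last first.
    move=> l /imsetP[w Cw ->] tw; rewrite mem_line_affine // form0r // add0r.
    have := memL w Cw; case: eqP => // _; rewrite tw !inE.
    by rewrite (negPf (lt0n_neq0 t0)) => /eqP.
  (* [v] is on the lines through 0 with the directions [u_0 = 1] and [u_1 = ii]. *)
  have vi (i : 'I_#|F'|.+1) :
      form F v.1 ((bseq (a + a^-1) i + bseq (a + a^-1) i.+1 * ii) / c) = 0.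
    have := vl _ _ (tangent i); rewrite mem_line // mul0r addr0 formC /= => vi.
    apply/eqP/vi/imset_f; rewrite inE subfield0 //= xpair_eqE eqxx andbT.
    by rewrite mulf_neq0 ?invr_eq0 ?conic_neq0.
  have v1 : form F v.1 c^-1 = 0 by have := vi ord0; rewrite /= mul0r addr0 mul1r.
  have vii : form F v.1 (ii / c) = 0.
    have := vi (Ordinal (leqW r1)).
    by rewrite /= mulr0 !add0r mul1r.
  have v0 : v.1 = 0 by apply: (form_eq0_basis hF _ Fii v1 vii); rewrite invr_eq0.
  move: Cv; rewrite inE => /andP[Fv2 vn0].
  have v2 : v.2 != 0 by apply: contraNneq vn0 => v2; rewrite (surjective_pairing v) v0 v2.
  by rewrite (surjective_pairing v) v0 -[RHS](pointZ hF _ Fv2 v2) /= mulr0 mulr1.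
Qed.
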